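(* Let $G$ be a finite abelian group (written additively), let $s$ be a positive integer, and let $B\subseteq G$ be a subset that is both a $B_s$ set and an additive basis of order $s$ of $G$. Then either $s=1$ and $B=G$, or $G\cong\mathbb{Z}_{s+1}$ and $|B|=2$.
   Context: For $B\subseteq G$, $sB$ denotes the set of all sums of exactly $s$ not-necessarily-distinct elements of $B$. $B$ is an additive basis of order $s$ of $G$ if $sB=G$. $B$ is a $B_s$ set if any two sums of $s$ not-necessarily-distinct elements of $B$ that are equal in $G$ consist of the same multiset of terms (i.e. all $s$-term sums are distinct up to the order of the terms). $\mathbb{Z}_n=\mathbb{Z}/n\mathbb{Z}$.
   Formalization: The formal statement additionally assumes that G is nontrivial when s ≥ 2; without this the claim is false, since for G = B = {0} and s ≥ 2 the set B is a B_s set and a basis of order s, but G is not isomorphic to Z_{s+1}. *)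

(* Defs.v *)
From HB Require Import structures.
From mathcomp Require Import all_boot all_order all_algebra.

Set Implicit Arguments.
Unset Strict Implicit.
Unset Printing Implicit Defensive.

Import GRing.Theory.
Local Open Scope ring_scope.

(* The multisets of size s over B are represented by s-tuples with all entries
   in B, taken up to [perm_eq]. *)

Definition sumset (G : finZmodType) (s : nat) (B : {set G}) : {set G} :=
  [set \sum_(b <- t) b | t : s.-tuple G & all (mem B) t].

Definition additive_basis (G : finZmodType) (s : nat) (B : {set G}) : Prop :=
  sumset s B = [set: G].

Definition Bs_set (G : finZmodType) (s : nat) (B : {set G}) : Prop :=
  forall t u : s.-tuple G, all (mem B) t -> all (mem B) u ->
    \sum_(b <- t) b = \sum_(b <- u) b -> perm_eq t u.

(* Main.v *)
(* A [B_s] set with [k] elements has [j]-fold sumsets of size [C(j + k - 1, j)]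
   for all [j <= s], so a basis of order [s] forces [#|G| = C(s + k - 1, s)].
   Counting the differences [p - c] with [p] in the [(s - 1)]-fold sumset and
   [c \in B] bounds [#|G|] from below; for [s >= 2] and [k >= 3] this exceeds
   [C(s + k - 1, s)].  For [B = {a, b}], the [s + 1] sums [i a + (s - i) b] are
   the elements [s b + i (a - b)], so [a - b] generates [G]. *)
Require Import Defs.
From HB Require Import structures.
From mathcomp Require Import all_boot all_order all_algebra.
From mathcomp Require Import fingroup cyclic zify.

Set Implicit Arguments.
Unset Strict Implicit.
Unset Printing Implicit Defensive.

Import GRing.Theory.
Local Open Scope ring_scope.

Section Sumsets.
Variable G : finZmodType.
Implicit Types (B : {set G}) (s : nat) (t u : seq G) (g x : G).

Lemma sumsetP s B g :
  reflect (exists t, [/\ size t = s, all (mem B) t & g = \sum_(b <- t) b])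
          (g \in sumset s B).
Proof.
apply: (iffP imsetP) => [[t tB ->]|[t [ts tB ->]]].
  by exists t; rewrite size_tuple; split => //; rewrite inE in tB.
by exists (tcast ts (in_tuple t)); rewrite ?inE val_tcast.
Qed.

Lemma Bs_setP s B t u : Bs_set s B -> size t = s -> size u = s ->
  all (mem B) t -> all (mem B) u ->
  \sum_(b <- t) b = \sum_(b <- u) b -> perm_eq t u.
Proof.
move=> BsB ts us tB uB.
have := BsB (tcast ts (in_tuple t)) (tcast us (in_tuple u)).
by rewrite !val_tcast; apply.
Qed.

Lemma Bs_setS s B : Bs_set s.+1 B -> Bs_set s B.
Proof.
move=> BsB t u tB uB e; case: s => [|s] in BsB t u tB uB e *.
  by rewrite (tuple0 t) (tuple0 u).
have xB : thead t \in B by apply: (allP tB); apply: mem_tnth.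
rewrite -(perm_cons (thead t)); apply: (Bs_setP BsB) => /=; rewrite ?size_tuple //.
- by rewrite xB.
- by rewrite xB.
- by rewrite !big_cons e.
Qed.

Lemma Bs_set_sub s B B' : B' \subset B -> Bs_set s B -> Bs_set s B'.
Proof.
move=> /subsetP sBB BsB t u tB uB; apply: BsB.
  exact: sub_all tB.
exact: sub_all uB.
Qed.

Lemma sumset0 B : sumset 0 B = [set 0].
Proof.
apply/setP => g; rewrite inE; apply/sumsetP/eqP => [[t [/size0nil -> _ ->]]|->].
  by rewrite big_nil.
by exists [::]; rewrite big_nil.
Qed.

Lemma sumset_set0 s : sumset s.+1 (set0 : {set G}) = set0.
Proof.
apply/setP => g; rewrite in_set0; apply/negP => /sumsetP[[|x t] [//= _]].
by rewrite inE.
Qed.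

Lemma sumset1 B : sumset 1 B = B.
Proof.
apply/setP => g; apply/sumsetP/idP => [[[|x [|y t]] [//= _]]|gB].
  by rewrite andbT big_seq1 => xB ->.
by exists [:: g]; rewrite big_seq1 /= gB.
Qed.

(** Sorts the sums by whether [x] occurs among their terms. For a [B_s] set the two parts are
    disjoint, which turns this split into Pascal's rule. *)
Lemma sumsetD1 s B x : x \in B ->
  sumset s.+1 B = [set x + g | g in sumset s B] :|: sumset s.+1 (B :\ x).
Proof.
move=> xB; apply/setP => g; rewrite inE.
apply/sumsetP/orP => [[t [ts tB ->]]|[/imsetP[h /sumsetP[t [ts tB ->]] ->]|]].
- have [xt|xt] := boolP (x \in t).
    left; apply/imsetP; exists (\sum_(b <- rem x t) b).
      apply/sumsetP; exists (rem x t); split => //; first by rewrite size_rem ?ts.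
      by apply/allP => y /mem_rem /(allP tB).
    by rewrite (perm_big _ (perm_to_rem xt)) big_cons.
  right; apply/sumsetP; exists t; split => //; apply/allP => y yt /=.
  by rewrite !inE (allP tB _ yt : y \in B) andbT; apply: contraNneq xt => <-.
- by exists (x :: t); rewrite /= xB ts big_cons.
- case/sumsetP=> t [ts tB ->]; exists t; split => //.
  by apply: sub_all tB => y; rewrite !inE => /andP[].
Qed.

Lemma Bs_sumsetD1_disjoint s B x : x \in B -> Bs_set s.+1 B ->
  [disjoint [set x + g | g in sumset s B] & sumset s.+1 (B :\ x)].
Proof.
move=> xB BsB; apply/pred0P => g /=; apply/negP => /andP[].
case/imsetP=> h /sumsetP[t [ts tB ->]] -> /sumsetP[u [us uB e]].
have /perm_mem/(_ x) : perm_eq (x :: t) u.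
  apply: (Bs_setP BsB) => //=; rewrite ?ts ?xB //; last by rewrite big_cons.
  by apply: sub_all uB => y; rewrite !inE => /andP[].
by rewrite mem_head => /esym /(allP uB); rewrite !inE eqxx.
Qed.

Lemma card_Bs_sumset s B : Bs_set s B -> #|sumset s B| = 'C((s + #|B|).-1, s).
Proof.
elim: s B => [|s IHs] B; first by rewrite sumset0 cards1 bin0.
(* Removing [x] keeps the number of terms but shrinks [B], hence an inner induction on [#|B|]. *)
have [k] := ubnP #|B|; elim: k B => // k IHk B leBk BsB.
have [->|[x xB]] := set_0Vmem B.
  by rewrite sumset_set0 !cards0 addn0 bin_small.
rewrite (sumsetD1 _ xB) cardsU disjoint_setI0 ?Bs_sumsetD1_disjoint // cards0 subn0.
rewrite card_imset; last exact: addrI.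
have cB := cardsD1 x B; rewrite xB add1n in cB.
rewrite IHs; last exact: Bs_setS.
rewrite IHk; [|lia|exact: Bs_set_sub (subsetDl _ _) BsB].
by rewrite cB !addnS !addSn /= binS addnC.
Qed.

(* With [r g] the number of [c \in B] such that [g + c] is in the [s.+1]-fold
   sumset, double counting gives [#|B| * #|sumset s.+1 B| = \sum_g r g].  If
   [g + c = p] and [g + c' = p'] with [c != c'], then [p + c' = p' + c] forces
   [c] to be a term of [p], so [r g > 1] only when [g \in sumset s B]. *)
Lemma Bs_double_count s B : Bs_set s.+2 B ->
  (#|B| * #|sumset s.+1 B| + #|sumset s B| <= #|B| * #|sumset s B| + #|G|)%N.
Proof.
move=> BsB; pose r g := #|[set c in B | g + c \in sumset s.+1 B]|.
have sum_r : (\sum_g r g = #|B| * #|sumset s.+1 B|)%N.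
  under eq_bigr => g _ do rewrite /r -sum1dep_card big_mkcondr.
  rewrite exchange_big /= -sum_nat_const; apply: eq_bigr => c _.
  rewrite -big_mkcond sum1dep_card -[RHS](card_imset _ (addIr (- c))).
  apply: eq_card => g; rewrite inE; apply/idP/imsetP => [gc|[p pS ->]].
    by exists (g + c); rewrite ?addrK.
  by rewrite subrK.
have r_le g : (r g <= #|B|)%N.
  by apply: subset_leq_card; apply/subsetP => c; rewrite inE => /andP[].
have r_le1 g : g \notin sumset s B -> (r g <= 1)%N.
  move=> gS; apply/card_le1_eqP => c c'; rewrite !inE.
  case/andP=> cB /sumsetP[t [ts tB et]] /andP[c'B /sumsetP[u [us uB eu]]].
  apply/eqP; apply: contraNT gS => cc'.
  have /perm_mem/(_ c) : perm_eq (c' :: t) (c :: u).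
    apply: (Bs_setP BsB) => /=; rewrite ?ts ?us ?cB ?c'B //.
    by rewrite !big_cons -et -eu addrCA [c + (g + c')]addrCA [c + c']addrC.
  rewrite mem_head inE eq_sym (negPf cc') /= => ct.
  apply/sumsetP; exists (rem c t); split; first by rewrite size_rem ?ts.
    by apply/allP => y /mem_rem /(allP tB).
  by apply: (addIr c); rewrite et (perm_big _ (perm_to_rem ct)) big_cons addrC.
(* Each [r g] is at most [#|B|] on [sumset s B] and at most 1 on its complement; the summand
   [#|sumset s B|] on the left completes that complement to [G]. *)
rewrite -sum_r (bigID (mem (sumset s B))) /=.
have h1 : (\sum_(g in sumset s B) r g <= #|B| * #|sumset s B|)%N.
  by rewrite mulnC -sum_nat_const; apply: leq_sum => g _.
have h2 : (\sum_(g | g \notin sumset s B) r g <= #|~: sumset s B|)%N.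
  rewrite -sum1_card big_mkcond [leqRHS]big_mkcond; apply: leq_sum => g _.
  by rewrite inE; case: ifP => // /r_le1.
apply: leq_trans (leq_add (leq_add h1 h2) (leqnn _)) _.
by rewrite -(cardsC (sumset s B)) -addnA [(#|~: _| + _)%N]addnC.
Qed.

Lemma card_Bs_basis_le2 s B : Bs_set s.+2 B -> additive_basis s.+2 B ->
  (#|B| <= 2)%N.
Proof.
move=> BsB basisB; rewrite leqNgt; apply/negP => B3.
have BsB1 := Bs_setS BsB; have BsB0 := Bs_setS BsB1.
have := Bs_double_count BsB.
rewrite -cardsT -basisB !card_Bs_sumset //.
have [n ->] : exists n, #|B| = n.+3 by exists (#|B| - 3)%N; lia.
(* With [a], [b], [c] the binomials of [N] over [s], [s.+1], [s.+2], the three sumsets have sizes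
   [a], [a + b] and [a + 2b + c], so the double count reduces to [(n + 1) b <= c]. *)
rewrite !addSn !addnS /= (binS (s + n).+3) !(binS (s + n).+2).
set N := (s + n).+2.
have b_gt0 : (0 < 'C(N, s.+1))%N by rewrite bin_gt0 /N; lia.
have bc := mul_bin_left N s.+1.
rewrite (_ : N - s.+1 = n.+1)%N in bc; last by rewrite /N; lia.
(* By [bc] the right side is [s.+2] times the left, and the left is nonzero since [b] is. *)
have lt_cb : ('C(N, s.+2) < n.+1 * 'C(N, s.+1))%N.
  rewrite -bc ltn_Pmull // lt0n; apply: contraTneq b_gt0 => c0.
  by move: bc; rewrite c0 muln0 => /esym/eqP; rewrite muln_eq0 /= => /eqP ->.
move: lt_cb; move: 'C(N, s) 'C(N, s.+1) 'C(N, s.+2) => a b c.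
lia.
Qed.

(** The map [i |-> x *+ i] out of the cyclic group is injective between sets of equal size; its
    inverse is the isomorphism. The case [m = 0] is excluded because ['Z_1] has two elements by
    convention. *)
Lemma Zp_additive_iso m (x : G) : (0 < m)%N -> #|G| = m.+1 -> x *+ m.+1 = 0 ->
  (forall i j, (i <= m)%N -> (j <= m)%N -> x *+ i = x *+ j -> i = j) ->
  exists f : {additive G -> 'Z_m.+1}, bijective f.
Proof.
case: m => // m _ cG xm xinj; pose h (i : 'Z_m.+2) := x *+ (i : nat).
have x_mod k : x *+ (k %% m.+2) = x *+ k.
  by rewrite [in RHS](divn_eq k m.+2) mulrnDr mulnC mulrnA xm mul0rn add0r.
have hB : zmod_morphism h.
  move=> i j; apply/eqP; rewrite eq_sym subr_eq; apply/eqP.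
  by rewrite /h -mulrnDr -[in RHS]x_mod -[in LHS](subrK j i).
have h_inj : injective h.
  by move=> i j e; apply/val_inj/xinj => //; rewrite -ltnS ltn_ord.
have [f hK fK] : bijective h by apply: inj_card_bij => //; rewrite cG card_ord.
pose hA := GRing.isZmodMorphism.Build _ _ h hB.
pose H : {additive 'Z_m.+2 -> G} := HB.pack h hA.
pose fA := GRing.isZmodMorphism.Build _ _ f (can2_zmod_morphism (f := H) hK fK).
pose F : {additive G -> 'Z_m.+2} := HB.pack f fA.
by exists F; exists h.
Qed.

Lemma Bs_pair_iso s B : (0 < s)%N -> Bs_set s B -> additive_basis s B ->
  #|B| = 2%N -> exists f : {additive G -> 'Z_s.+1}, bijective f.
Proof.
move=> s_gt0 BsB basisB cB.
have cG : #|G| = s.+1.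
  by rewrite -cardsT -basisB card_Bs_sumset // cB addn2 binSn.
have /eqP/cards2P[a [b [ab eB]]] := cB.
apply: (@Zp_additive_iso s (a - b)) => // [|i j le_is le_js e].
  by rewrite -cG -FinRing.zmodXgE -cardsT expg_cardG ?inE.
(* Equal multiples of [a - b] give words with equal sums, and the number of occurrences of [a] then
   recovers the multiplier. *)
pose w k := nseq k a ++ nseq (s - k) b.
have wE k : (k <= s)%N -> \sum_(y <- w k) y = (a - b) *+ k + b *+ s.
  move=> ks; rewrite big_cat !big_nseq /= !iter_addr_0.
  by rewrite mulrnBl mulrnBr // addrA addrAC.
have /permP/(_ (pred1 a)) : perm_eq (w i) (w j).
  apply: (Bs_setP BsB); rewrite ?size_cat ?size_nseq ?subnKC ?all_cat ?all_nseq //=.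
  - by rewrite eB !inE !eqxx !orbT.
  - by rewrite eB !inE !eqxx !orbT.
  - by rewrite !wE // e.
by rewrite !count_cat !count_nseq /= eqxx eq_sym (negPf ab) !mul1n !mul0n !addn0.
Qed.
End Sumsets.

Theorem theorem2 (G : finZmodType) (s : nat) (B : {set G})
    (s_gt0 : (0 < s)%N)
    (G_nontrivial : (1 < s)%N -> (1 < #|G|)%N)
    (B_Bs : Bs_set s B)
    (B_basis : additive_basis s B) :
  (s = 1%N /\ B = [set: G]) \/
  ((exists f : {additive G -> 'Z_s.+1}, bijective f) /\ #|B| = 2%N).
Proof.
case: s => [|[|s]] // in s_gt0 G_nontrivial B_Bs B_basis *.
  by left; split=> //; rewrite -B_basis sumset1.
right; have cB : #|B| = 2%N.
  (* An empty [B] would give [#|G| = 0] and a singleton [#|G| = 1], both against [G_nontrivial]. *)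
  have := card_Bs_basis_le2 B_Bs B_basis.
  have := G_nontrivial isT; rewrite -cardsT -B_basis card_Bs_sumset //.
  case: #|B| => [|[|[|]]] //; first by rewrite bin_small ?addn0.
  by rewrite addn1 binn.
by split=> //; apply: (Bs_pair_iso s_gt0 B_Bs).
Qed.
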